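(* For any positive integer $n$, we have $$\operatorname{per}\left[\left\lfloor\frac{j+k-1}{n}\right\rfloor\right]_{1\le j,k\le n}=1$$ and $$\operatorname{per}\left[\left[\left\lfloor\frac{j+k}{n}\right\rfloor\right]_q\right]_{1\le j,k\le n}=2^{n-1}+q.$$
   Context: The permanent of an $N\times N$ matrix $A=[a_{j,k}]$ is $\operatorname{per}(A)=\sum_{\tau\in S_N}\prod_{j=1}^{N}a_{j,\tau(j)}$, where the sum runs over all permutations $\tau$ of the index set. The $q$-analogue of an integer $m$ is $[m]_q=(1-q^m)/(1-q)$, where $q$ is an indeterminate; in particular $[0]_q=0$, $[1]_q=1$, $[2]_q=1+q$. $\lfloor\cdot\rfloor$ is the floor function. *)

(* Defs.v *)
From mathcomp Require Import all_boot all_order all_algebra all_fingroup.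

Set Implicit Arguments.
Unset Strict Implicit.
Unset Printing Implicit Defensive.

Import Order.TTheory GRing.Theory Num.Theory.
Local Open Scope ring_scope.

Definition permanent (R : comNzRingType) (N : nat) (A : 'M[R]_N) : R :=
  \sum_(tau : 'S_N) \prod_(j < N) A j (tau j).

(* The indeterminate q lives in Q(q), the fraction field of Z[q], so that the
   quotient defining [m]_q makes sense for every integer m. *)
Definition Qq : fieldType := {fraction {poly int}}.

Definition q : Qq := FracField.tofrac ('X : {poly int}).

Definition qint (m : int) : Qq := (1 - q ^ m) / (1 - q).

(* Main.v *)
Require Import Defs.
From mathcomp Require Import all_boot all_order all_algebra all_fingroup.
From mathcomp Require Import zify.
Import Order.TTheory GRing.Theory Num.Theory.
Local Open Scope ring_scope.

(** Let the indices run over 0, ..., n-1 and read the columns backwards, that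
    is, replace column k by column n-1-k; a permanent does not notice
    ([permanent_col_perm]).  The first matrix becomes the 0/1 matrix of the
    relation k <= j, lower triangular with unit diagonal, so its permanent
    is 1.  The second one becomes the 0/1 matrix of k <= j + 1 (a full lower
    Hessenberg matrix), with q added to the bottom left entry, the only place
    where j + k reaches 2n in the original 1-based indices and where the entry
    is therefore [2]_q = 1 + q.

    Both permanents follow from expansion along the top row
    ([permanent_expand_row0]), because striking out the top row and a column
    meeting its support gives a smaller matrix of the same shape.  In the
    Hessenberg case the top row is (1, 1, 0, ..., 0).  Striking out column 0
    also removes the perturbed corner, whereas striking out column 1 keeps it.
    With P_n(x) the permanent for corner perturbation x, this says
    P_(n+1)(x) = P_n(0) + P_n(x) for n >= 1.  Since P_1(x) = 1 + x, it follows
    that P_n(x) = 2^(n-1) + x for all x, by induction. *)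

Lemma permanent_col_perm (R : comNzRingType) (n : nat) (s : 'S_n)
    (A : 'M[R]_n) :
  permanent (col_perm s A) = permanent A.
Proof.
rewrite /permanent [RHS](reindex_inj (mulIg s)) /=.
by apply: eq_bigr => t _; apply: eq_bigr => j _; rewrite mxE permM.
Qed.

(** The permutations sending 0 to k correspond, through [lift_perm], to the
    bijections from the remaining rows to the remaining columns. *)
Lemma permanent_expand_row0 (R : comNzRingType) (n : nat) (A : 'M[R]_n.+1) :
  permanent A = \sum_k A ord0 k * permanent (row' ord0 (col' k A)).
Proof.
rewrite /permanent (partition_big (fun s : 'S_n.+1 => s ord0) predT) //=.
apply: eq_bigr => k _; rewrite big_distrr /=.
rewrite (reindex (lift_perm ord0 k)) /=; last first.
  (* The inverse reads off the position of s (lift 0 j) among the columns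
     other than s 0.  Using s 0 rather than k keeps it an injective function
     of j for every s, so that it is a permutation even when s 0 <> k; the
     default value j is never reached. *)
  pose rest (s : 'S_n.+1) j := odflt j (unlift (s ord0) (s (lift ord0 j))).
  have restE (s : 'S_n.+1) j : lift (s ord0) (rest s j) = s (lift ord0 j).
    rewrite /rest; case: unliftP => //= /perm_inj /eqP.
    by rewrite eq_sym (negPf (neq_lift _ _)).
  have rest_inj (s : 'S_n.+1) : injective (rest s).
    move=> j1 j2 eq_j; apply/(@lift_inj _ ord0)/(@perm_inj _ s).
    by rewrite -!restE eq_j.
  exists (fun s => perm (rest_inj s)) => [s _ | s /eqP s0]; apply/permP=> j.
    apply: (@lift_inj _ k); rewrite permE.
    by rewrite -{1}(lift_perm_id ord0 k s) restE lift_perm_lift.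
  case: (unliftP ord0 j) => [j'|] ->; last by rewrite lift_perm_id.
  by rewrite lift_perm_lift permE -s0 restE.
apply: eq_big => [s|s _]; first by rewrite lift_perm_id eqxx.
rewrite big_ord_recl lift_perm_id; congr (_ * _).
by apply: eq_bigr => j _; rewrite !mxE lift_perm_lift.
Qed.

Lemma permanent_mx0 (R : comNzRingType) (A : 'M[R]_0) : permanent A = 1.
Proof.
rewrite /permanent (bigD1 1%g) //= big_ord0 big1 ?addr0 // => s /eqP[].
by apply/permP=> -[].
Qed.

Lemma permanent_lower_ones (R : comNzRingType) (n : nat) :
  permanent (\matrix_(j < n, k < n) (k <= j)%N%:R : 'M[R]_n) = 1.
Proof.
elim: n => [|n IHn]; first exact: permanent_mx0.
rewrite permanent_expand_row0 big_ord_recl big1 ?addr0 => [|k _]; last first.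
  by rewrite mxE mul0r.
rewrite mxE mul1r -[RHS]IHn; congr permanent.
by apply/matrixP=> j k; rewrite !mxE.
Qed.

(** The perturbation x is part of the statement because the two minors in the
    expansion are instances of it at 0 and at x, which makes the induction
    close. *)
Lemma permanent_hessenberg_corner (R : comNzRingType) (n : nat) (x : R) :
  permanent (\matrix_(j < n.+1, k < n.+1)
     ((k <= j.+1)%N%:R + x *+ ((j == ord_max) && (k == ord0))))
  = 2 ^+ n + x.
Proof.
elim: n x => [|n IHn] x.
  rewrite permanent_expand_row0 big_ord1 permanent_mx0 mxE mulr1.
  by rewrite (ord1 ord_max) eqxx expr0.
rewrite permanent_expand_row0 2!big_ord_recl big1 ?addr0 => [|k _]; last first.
  by rewrite mxE /= addr0 mul0r.
have minor0 : row' ord0 (col' ord0 (\matrix_(j < n.+2, k < n.+2)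
    ((k <= j.+1)%N%:R + x *+ ((j == ord_max) && (k == ord0)))))
  = \matrix_(j < n.+1, k < n.+1)
    ((k <= j.+1)%N%:R + 0 *+ ((j == ord_max) && (k == ord0))).
  apply/matrixP=> j k; rewrite !mxE /= mul0rn.
  by rewrite andbF mulr0n.
have minor1 : row' ord0 (col' (lift ord0 ord0) (\matrix_(j < n.+2, k < n.+2)
    ((k <= j.+1)%N%:R + x *+ ((j == ord_max) && (k == ord0)))))
  = \matrix_(j < n.+1, k < n.+1)
    ((k <= j.+1)%N%:R + x *+ ((j == ord_max) && (k == ord0))).
  (* the surviving columns are 0, 2, 3, ...: column 0 is full, like the first
     column of the smaller matrix *)
  by apply/matrixP=> j [[|k] ltkn]; rewrite !mxE.
rewrite minor0 minor1 !IHn !mxE /= !mulr0n !addr0 !mul1r.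
by rewrite addrA -mulr2n -[_ *+ 2]mulr_natl -exprS.
Qed.

Lemma qint0 : qint 0 = 0.
Proof. by rewrite /qint expr0z subrr mul0r. Qed.

Lemma one_sub_q_neq0 : 1 - q != 0.
Proof.
rewrite subr_eq0 eq_sym -tofrac1 tofrac_eq.
by rewrite -(inj_eq val_inj) /= polyseqX polyseq1.
Qed.

Lemma qint1 : qint 1 = 1.
Proof. by rewrite /qint expr1z divff // one_sub_q_neq0. Qed.

Lemma qint2 : qint 2 = 1 + q.
Proof.
rewrite /qint -exprnP -{1}(expr1n Qq 2) subr_sqr.
by rewrite mulrAC divff ?mul1r // one_sub_q_neq0.
Qed.

Lemma divn_sum_pred_rev (n : nat) (j k : 'I_n) :
  ((j.+1 + (rev_ord k).+1 - 1) %/ n = (k <= j))%N.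
Proof.
have ltjn := ltn_ord j; have ltkn := ltn_ord k; rewrite /=.
have [lekj|ltjk] := leqP k j; last by rewrite divn_small //; lia.
have ->: (j.+1 + (n - k.+1).+1 - 1 = n + (j - k))%N by lia.
by rewrite divnDl ?dvdnn // divnn divn_small; lia.
Qed.

(** The index sum is n.+1 + (j.+1 - k) when k <= j.+1, and the second term
    reaches n.+1 only in the bottom left corner. *)
Lemma divn_sum_rev (n : nat) (j k : 'I_n.+1) :
  ((j.+1 + (rev_ord k).+1) %/ n.+1
   = (k <= j.+1) + ((j == ord_max) && (k == ord0)))%N.
Proof.
have ltjn := ltn_ord j; have ltkn := ltn_ord k.
rewrite -!val_eqE /=.
have [lekj|ltjk] := leqP k j.+1; last by rewrite divn_small; lia.
have ->: (j.+1 + (n.+1 - k.+1).+1 = n.+1 + (j.+1 - k))%N by lia.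
rewrite divnDl ?dvdnn // divnn /=; congr (_ + _)%N.
case: (boolP ((j == n :> nat) && (k == 0 :> nat)%N)) => [/andP[/eqP-> /eqP->]|].
  by rewrite subn0 divnn.
by move=> notcorner; rewrite divn_small //; lia.
Qed.

(* The ordinals j, k : 'I_n range over 0, ..., n-1, so j.+1 and k.+1 are the
   1-based indices. *)
Theorem theorem1 (n : nat) (hn : (0 < n)%N) :
  permanent (\matrix_(j < n, k < n) (((j.+1 + k.+1 - 1) %/ n)%N%:Z : int)) = 1
  /\ permanent (\matrix_(j < n, k < n) qint (((j.+1 + k.+1) %/ n)%N%:Z))
     = 2 ^+ n.-1 + q.
Proof.
split.
  rewrite -(permanent_col_perm _ _ (perm rev_ord_inj)) -[RHS](permanent_lower_ones _ n).
  congr permanent; apply/matrixP=> j k; rewrite !mxE permE divn_sum_pred_rev.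
  by rewrite natz.
case: n hn => // n _.
rewrite -(permanent_col_perm _ _ (perm rev_ord_inj)) -permanent_hessenberg_corner.
congr permanent; apply/matrixP=> j k; rewrite !mxE permE divn_sum_rev.
(* the corner (n, 0) satisfies k <= j + 1, so the value 2 arises as 1 + 1 *)
case: (boolP (_ && _)) => [/andP[_ /eqP->]|_]; first exact: qint2.
by rewrite addn0 addr0; case: leqP => _; [exact: qint1 | exact: qint0].
Qed.
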